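(* Let $\Delta$ be a finite signature (finitely many nominals, relation symbols and propositional symbols). (1) For every pointed $\Delta$-model $(\mathfrak{M},w)$ and every gameboard tree $tr$ with root labelled $\Delta$, there exists a unique game sentence $\varphi\in\Theta_{tr}$ such that $(\mathfrak{M},w)\models\varphi$. (2) For all pointed $\Delta$-models $(\mathfrak{M},w)$, $(\mathfrak{N},v)$ and every gameboard tree $tr$ with root labelled $\Delta$, the following are equivalent: (a) $(\mathfrak{M},w)\approx_{tr}(\mathfrak{N},v)$; (b) there exists a unique game sentence $\varphi\in\Theta_{tr}$ such that $(\mathfrak{M},w)\models\varphi$ and $(\mathfrak{N},v)\models\varphi$. (3) For every $\mathcal{L}$-sentence $\phi$ over $\Delta$ there exist a gameboard tree $tr$ with root labelled $\Delta$ and a set $\Psi_\phi\subseteq\Theta_{tr}$ such that $\phi\leftrightarrow\bigvee\Psi_\phi$ is a tautology (i.e. $\phi$ and $\bigvee\Psi_\phi$ are satisfied by exactly the same pointed $\Delta$-models).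
   Context: Hybrid-dynamic propositional logic (HDPL). A signature is $\Delta=((F,P),\mathtt{Prop})$ with $F$ a set of nominals, $P$ a set of binary relation symbols and $\mathtt{Prop}$ a set of propositional symbols. For a fresh symbol $x$ (a variable), $\Delta[x]$ is $\Delta$ with $x$ added as a new nominal. A $\Delta$-model (Kripke structure) $\mathfrak{M}$ consists of a nonempty set $|\mathfrak{M}|$ of states, a state $k^{\mathfrak{M}}$ for each $k\in F$, a relation $\lambda^{\mathfrak{M}}\subseteq|\mathfrak{M}|^2$ for each $\lambda\in P$, and a map $M$ assigning to each state $w$ a set $M(w)\subseteq\mathtt{Prop}$. For $w\in|\mathfrak{M}|$, $\mathfrak{M}[x\leftarrow w]$ is the $\Delta[x]$-expansion of $\mathfrak{M}$ interpreting $x$ as $w$. Actions over $\Delta$: $\mathfrak{a}::=\lambda\mid\mathfrak{a}\cup\mathfrak{a}\mid\mathfrak{a};\mathfrak{a}\mid\mathfrak{a}^*$ ($\lambda\in P$), interpreted as union, diagrammatic composition and reflexive-transitive closure of relations; $\mathfrak{a}^{\mathfrak{M}}(w)=\{w'\mid(w,w')\in\mathfrak{a}^{\mathfrak{M}}\}$. Sentences over $\Delta$: $\phi::=p\mid k\mid\bigwedge\Phi\mid\neg\phi\mid\langle\mathfrak{a}\rangle\phi\mid @_k\phi\mid{\downarrow}x.\phi_x\mid\exists x.\phi_x$, with $p\in\mathtt{Prop}$, $k\in F$, $\Phi$ a finite set of sentences, $x$ a fresh variable and $\phi_x$ a $\Delta[x]$-sentence. Satisfaction at a pointed model $(\mathfrak{M},w)$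 ($w\in|\mathfrak{M}|$): $p$ iff $p\in M(w)$; $k$ iff $w=k^{\mathfrak{M}}$; Boolean connectives as usual; $\langle\mathfrak{a}\rangle\phi$ iff $(\mathfrak{M},w')\models\phi$ for some $w'\in\mathfrak{a}^{\mathfrak{M}}(w)$; $@_k\phi$ iff $(\mathfrak{M},k^{\mathfrak{M}})\models\phi$; ${\downarrow}x.\phi_x$ iff $(\mathfrak{M}[x\leftarrow w],w)\models\phi_x$; $\exists x.\phi_x$ iff $(\mathfrak{M}[x\leftarrow u],w)\models\phi_x$ for some $u\in|\mathfrak{M}|$. Abbreviations: $\bigvee$, $[\mathfrak{a}]\phi=\neg\langle\mathfrak{a}\rangle\neg\phi$, $\forall x=\neg\exists x\neg$. Fragment: $\mathcal{L}$ is a fixed fragment of HDPL obtained by discarding some action constructors ($\cup$, $;$, $^*$) and/or some of the sentence constructors possibility ($\Diamond$), retrieve ($@$), store ($\downarrow$), existential quantification ($\exists$); atoms and Boolean connectives are always kept. $\mathcal{O}\subseteq\{\Diamond,@,\downarrow,\exists\}$ is the set of retained constructors, $\mathcal{A}(\Delta)$ the set of $\mathcal{L}$-actions over $\Delta$. Basic sentences: $\mathrm{Sen}_b(\Delta)=F\cup\mathtt{Prop}$. Gameboard trees: a finite rooted tree whose nodes are labelled by signatures and whose edges are labelled, distinct edges out of a node carrying distinct labels; each edge from a node labelled $\Delta$ is one of: $\Delta\xrightarrow{\langle\mathfrak{a}\rangle}\Delta$ with $\mathfrak{a}\in\mathcal{A}(\Delta)$ (only if $\Diamond\in\mathcal{O}$);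 $\Delta\xrightarrow{@_k}\Delta$ with $k$ a nominal of $\Delta$ (only if $@\in\mathcal{O}$); $\Delta\xrightarrow{\downarrow}\Delta[x]$ (only if $\downarrow\in\mathcal{O}$); $\Delta\xrightarrow{\exists}\Delta[x]$ (only if $\exists\in\mathcal{O}$); $\Delta\xrightarrow{1}\Delta$ (idle); $x$ is a fresh variable and the child node is labelled by the target signature. EF game on a gameboard tree $tr$: two players, Abelard and Eloise; a position is a node of $tr$ labelled $\Delta'$ together with two pointed $\Delta'$-models; the game starts at the root with $(\mathfrak{M},w),(\mathfrak{N},v)$. At each position Eloise loses if the game property fails, i.e. if some basic sentence $\rho\in\mathrm{Sen}_b(\Delta')$ is satisfied by exactly one of the two pointed models. Otherwise, if the node has children, Abelard chooses an outgoing edge and one of the two pointed models, say $(\mathfrak{M},w)$ (the other choice is symmetric), and the play moves to the child: for $\langle\mathfrak{a}\rangle$, Abelard picks $w_1\in\mathfrak{a}^{\mathfrak{M}}(w)$ and Eloise must pick $v_1\in\mathfrak{a}^{\mathfrak{N}}(v)$, new pair $(\mathfrak{M},w_1),(\mathfrak{N},v_1)$; for $@_k$, new pair $(\mathfrak{M},k^{\mathfrak{M}}),(\mathfrak{N},k^{\mathfrak{N}})$; for $\downarrow$, new pair $(\mathfrak{M}[x\leftarrow w],w),(\mathfrak{N}[x\leftarrow v],v)$; for $\exists$, Abelard picks $w_1\in|\mathfrak{M}|$, Eloise picks $v_1\in|\mathfrak{N}|$, new pair $(\mathfrak{M}[x\leftarrow w_1],w),(\mathfrak{N}[x\leftarrow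 v_1],v)$; for $1$, the pair is unchanged. Eloise wins if she can always respond so that the game property holds at every position reached. $(\mathfrak{M},w)\approx_{tr}(\mathfrak{N},v)$ means Eloise has a winning strategy. Game sentences $\Theta_{tr}$ (root labelled by a finite signature), by induction on $tr$: if $tr$ is a single node $\Delta$, $\Theta_{\Delta}=\{\bigwedge_{\rho\in\mathrm{Sen}_b(\Delta)}\rho^{f(\rho)}\mid f:\mathrm{Sen}_b(\Delta)\to\{0,1\}\}$ with $\rho^0=\rho,\rho^1=\neg\rho$. If the root $\Delta$ has edges labelled $lb_1,\dots,lb_n$ to subtrees $tr_1,\dots,tr_n$, for each $i$ define $S_i$ and $\varphi_\Gamma$ ($\Gamma\in S_i$): for $\langle\mathfrak{a}\rangle$: $S_i=\mathcal{P}(\Theta_{tr_i})$, $\varphi_\Gamma=(\bigwedge_{\gamma\in\Gamma}\langle\mathfrak{a}\rangle\gamma)\wedge[\mathfrak{a}]\bigvee\Gamma$; for $@_k$: $S_i=\{\{\gamma\}\mid\gamma\in\Theta_{tr_i}\}$, $\varphi_{\{\gamma\}}=@_k\gamma$; for $\downarrow$: singletons, $\varphi_{\{\gamma\}}={\downarrow}x.\gamma$; for $\exists$: $S_i=\mathcal{P}(\Theta_{tr_i})$, $\varphi_\Gamma=(\bigwedge_{\gamma\in\Gamma}\exists x.\gamma)\wedge\forall x.\bigvee\Gamma$; for $1$: singletons, $\varphi_{\{\gamma\}}=\gamma$. Then $\Theta_{tr}=\{\varphi_{\Gamma_1}\wedge\dots\wedge\varphi_{\Gamma_n}\mid\Gamma_i\in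 S_i\}$.
   Formalization: In (2), (b)⇒(a) is false for the displayed game sentences (an edge ⟨λ⟩ or @k forgets the root's basic sentences); it is proved for game sentences with a basic type of the node's signature conjoined at each inner node. (1), (3) and (a)⇒(b) hold for both versions. *)

(* Defs.v *)
From Stdlib Require Export List Relation_Operators.
From mathcomp Require Export all_boot.

Set Implicit Arguments.
Unset Strict Implicit.
Unset Printing Implicit Defensive.

Definition every (T : Type) (P : T -> Prop) : seq T -> Prop :=
  foldr (fun x Q => P x /\ Q) True.

(* Signatures are finite. *)
Record signature := Signature {
  nominals : finType;
  modalities : finType;
  props : finType
}.

(* Delta[x]: the fresh nominal x is [None], a nominal k of Delta is [Some k];
   bound variables are thereby nameless, so sentences are taken up to
   alpha-equivalence. *)
Definition ext (S : signature) : signature :=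
  @Signature (option (nominals S)) (modalities S) (props S).

Record model (S : signature) := Model {
  state :> Type;
  nonempty : inhabited state;
  nomI : nominals S -> state;
  modI : modalities S -> state -> state -> Prop;
  propI : state -> props S -> Prop
}.

Definition expand (S : signature) (M : model S) (u : M) : model (ext S) :=
  @Model (ext S) (state M) (nonempty M)
    (fun o : option (nominals S) => if o is Some k then nomI M k else u)
    (@modI S M) (@propI S M).

Inductive action (P : Type) : Type :=
| Atom of P
| Union of action P & action P
| Comp of action P & action P
| Star of action P.

Fixpoint actI (S : signature) (M : model S) (a : action (modalities S))
    : M -> M -> Prop :=
  match a with
  | Atom r => modI (m := M) r
  | Union a b => fun w v => actI a w v \/ actI b w v
  | Comp a b => fun w v => exists2 u, actI a w u & actI b u v
  | Star a => clos_refl_trans M (actI a)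
  end.

(* The argument of [And] lists the members of a finite set. *)
Inductive sen (S : signature) : Type :=
| Prp of props S
| Nom of nominals S
| And of seq (sen S)
| Not of sen S
| Dia of action (modalities S) & sen S
| At of nominals S & sen S
| Store of sen (ext S)
| Ex of sen (ext S).

Definition Or (S : signature) (Phi : seq (sen S)) : sen S :=
  Not (And [seq Not phi | phi <- Phi]).
Definition Box (S : signature) (a : action (modalities S)) (phi : sen S) :=
  Not (Dia a (Not phi)).
Definition All (S : signature) (phi : sen (ext S)) : sen S :=
  Not (Ex (Not phi)).

Fixpoint sat (S : signature) (phi : sen S) : forall M : model S, M -> Prop :=
  match phi with
  | Prp p => fun M w => propI w p
  | Nom k => fun M w => w = nomI M k
  | And Phi => fun M w => every (fun psi => sat psi (M := M) w) Phi
  | Not psi => fun M w => ~ sat psi w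
  | Dia a psi => fun M w => exists2 w', actI a w w' & sat psi w'
  | At k psi => fun M _ => sat psi (nomI M k)
  | Store psi => fun M w => sat psi (M := expand w) w
  | Ex psi => fun M w => exists u : M, sat psi (M := expand u) w
  end.

Record fragment := Fragment {
  has_union : bool;
  has_comp : bool;
  has_star : bool;
  has_dia : bool;
  has_at : bool;
  has_store : bool;
  has_ex : bool
}.

Fixpoint action_in (L : fragment) (P : Type) (a : action P) : bool :=
  match a with
  | Atom _ => true
  | Union a b => [&& has_union L, action_in L a & action_in L b]
  | Comp a b => [&& has_comp L, action_in L a & action_in L b]
  | Star a => has_star L && action_in L a
  end.

Fixpoint sen_in (L : fragment) (S : signature) (phi : sen S) : bool :=
  match phi with
  | Prp _ | Nom _ => true
  | And Phi => all (fun psi => sen_in L psi) Phi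
  | Not psi => sen_in L psi
  | Dia a psi => [&& has_dia L, action_in L a & sen_in L psi]
  | At _ psi => has_at L && sen_in L psi
  | Store psi => has_store L && sen_in L psi
  | Ex psi => has_ex L && sen_in L psi
  end.

Inductive label (S : signature) : Type :=
| LDia of action (modalities S)
| LAt of nominals S
| LStore
| LEx
| LIdle.
Arguments LStore {S}.
Arguments LEx {S}.
Arguments LIdle {S}.

Definition target (S : signature) (l : label S) : signature :=
  match l with
  | LStore | LEx => ext S
  | _ => S
  end.

Definition label_in (L : fragment) (S : signature) (l : label S) : bool :=
  match l with
  | LDia a => has_dia L && action_in L a
  | LAt _ => has_at L
  | LStore => has_store L
  | LEx => has_ex L
  | LIdle => true
  end.

Inductive tree (S : signature) : Type :=
| Node of seq {l : label S & tree (target l)}.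

Fixpoint gameboard (L : fragment) (S : signature) (t : tree S) : Prop :=
  let: Node es := t in
  NoDup [seq projT1 e | e <- es] /\
  every (fun e => label_in L (projT1 e) /\ gameboard L (projT2 e)) es.

Definition basic (S : signature) : seq (sen S) :=
  [seq Nom k | k <- enum (nominals S)] ++ [seq Prp p | p <- enum (props S)].

Definition game_property (S : signature) (M N : model S) (w : M) (v : N) :=
  forall rho, In rho (basic S) -> (sat rho w <-> sat rho v).

(* [W] says that Eloise wins from a given position at the child node. *)
Definition round (S : signature) (l : label S) :
    (forall M N : model (target l), M -> N -> Prop) ->
    forall M N : model S, M -> N -> Prop :=
  match l with
  | LDia a => fun W M N w v =>
      (forall w1, actI a w w1 -> exists2 v1, actI a v v1 & W M N w1 v1) /\
      (forall v1, actI a v v1 -> exists2 w1, actI a w w1 & W M N w1 v1)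
  | LAt k => fun W M N _ _ => W M N (nomI M k) (nomI N k)
  | LStore => fun W M N w v => W (expand w) (expand v) w v
  | LEx => fun W M N w v =>
      (forall w1 : M, exists v1 : N, W (expand w1) (expand v1) w v) /\
      (forall v1 : N, exists w1 : M, W (expand w1) (expand v1) w v)
  | LIdle => fun W => W
  end.

(* (M,w) ~~_t (N,v), by backward induction on the finite tree t. *)
Fixpoint eloise_wins (S : signature) (t : tree S) :
    forall M N : model S, M -> N -> Prop :=
  fun M N w v =>
  let: Node es := t in
  game_property w v /\
  every (fun e => round (l := projT1 e) (eloise_wins (projT2 e)) w v) es.

(* Subsets of a duplicate-free enumeration, each enumerated once, in the order
   of that enumeration. *)
Fixpoint sublists (T : Type) (s : seq T) : seq (seq T) :=
  if s is x :: s' then [seq x :: r | r <- sublists s'] ++ sublists s'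
  else [:: [::]].

(* All [:: x1; ..; xn] with each xi taken from the i-th list. *)
Fixpoint choices (T : Type) (ss : seq (seq T)) : seq (seq T) :=
  if ss is s :: ss' then [seq x :: r | x <- s, r <- choices ss']
  else [:: [::]].

Definition basic_types (S : signature) : seq (sen S) :=
  [seq And Phi | Phi <- choices [seq [:: rho; Not rho] | rho <- basic S]].

(* The sentences phi_Gamma of an edge, [Theta] being those of its subtree. *)
Definition edge_sentences (S : signature) (l : label S) :
    seq (sen (target l)) -> seq (sen S) :=
  match l with
  | LDia a => fun Theta =>
      [seq And [:: And [seq Dia a gamma | gamma <- Gamma]; Box a (Or Gamma)]
      | Gamma <- sublists Theta]
  | LAt k => fun Theta => [seq At k gamma | gamma <- Theta]
  | LStore => fun Theta => [seq Store gamma | gamma <- Theta]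
  | LEx => fun Theta =>
      [seq And [:: And [seq Ex gamma | gamma <- Gamma]; All (Or Gamma)]
      | Gamma <- sublists Theta]
  | LIdle => fun Theta => Theta
  end.

(* At an inner node, [EdgesOnly] gives the conjunctions
   phi_Gamma1 /\ .. /\ phi_Gamman of sentences of the outgoing edges, and
   [WithRoot] gives these with a basic type of the node's signature as one more
   conjunct; on leaves the two agree. [EdgesOnly] sentences need not determine
   the basic sentences at the root, since Dia and At leave the current state:
   states that satisfy p and not p, and have no successors, share a sentence on
   a root with a single Dia-edge, although Eloise has lost at that root. *)
Variant conjuncts := EdgesOnly | WithRoot.

Fixpoint game_sentences (c : conjuncts) (S : signature) (t : tree S)
    : seq (sen S) :=
  let: Node es := t in
  let edges := [seq edge_sentences (l := projT1 e) (game_sentences c (projT2 e))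
               | e <- es] in
  match es, c with
  | [::], _ => basic_types S
  | _, EdgesOnly => [seq And Phi | Phi <- choices edges]
  | _, WithRoot => [seq And Phi | Phi <- choices (basic_types S :: edges)]
  end.

(* Main.v *)
Require Import Defs.
From Stdlib Require Import Classical ClassicalEpsilon FinFun.

Set Implicit Arguments.
Unset Strict Implicit.
Unset Printing Implicit Defensive.

(** Call two pointed models equivalent for a set Theta of sentences when they
    satisfy a common member of Theta. If Theta is a finite set of mutually
    exclusive sentences covering all pointed models, then so are the edge
    sentences built from Theta, and equivalence for the latter is one round of
    the game played with equivalence for Theta. By induction on the tree, the
    game sentences partition the pointed models, and equivalence for them follows
    from the existence of a winning strategy, to which it amounts when the game
    sentences record the basic sentences at every node.
    For the third part, no two trees have to be merged: every sentence is decided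
    by all sufficiently large trees of a single family, the complete trees of
    depth n over a finite set of actions, in which every node has an idle edge so
    that deeper trees decide at least as much. *)

(** * Lists, sublists and choices *)

Lemma everyP (T : Type) (P : T -> Prop) s :
  every P s <-> forall x, In x s -> P x.
Proof.
elim: s => [|x s IH] /=; first by split.
split=> [[Px /IH Ps] y [<- //|/Ps //]|Ps].
by split; [apply: Ps; left | apply/IH => y ys; apply: Ps; right].
Qed.

Lemma In_map (T U : Type) (f : T -> U) s y :
  In y [seq f x | x <- s] <-> exists x, f x = y /\ In x s.
Proof. exact: in_map_iff. Qed.

Lemma In_enum (T : finType) (x : T) : In x (enum T).
Proof.
have: x \in enum T by rewrite mem_enum.
elim: (enum T) => //= y s IH; rewrite inE => /orP[/eqP->|/IH]; by [left | right].
Qed.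

Lemma NoDup_map_inj (T U : Type) (f : T -> U) s :
  injective f -> NoDup s -> NoDup [seq f x | x <- s].
Proof. by move=> injf; apply: Injective_map_NoDup => x y /injf. Qed.

Lemma In_sublists (T : Type) (s r : seq T) x :
  In r (sublists s) -> In x r -> In x s.
Proof.
elim: s r => [|y s IH] r /=; first by case=> // <-.
case/in_app_iff => [/In_map[q [<- qs]] [->|xq]|rs xr]; [by left| |];
  right; [exact: IH xq | exact: IH xr].
Qed.

(** Excluded middle allows [P] to be any predicate, such as being satisfied after some move. *)
Lemma sublists_comprehension (T : Type) (P : T -> Prop) s :
  exists2 r, In r (sublists s) & forall x, In x r <-> In x s /\ P x.
Proof.
elim: s => [|y s [r rs rP]] /=; first by exists [::]; [left | move=> x /=; tauto].
have [Py|nPy] := classic (P y).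
  exists (y :: r); first by apply/in_app_iff; left; apply/In_map; exists r.
  by move=> x /=; rewrite rP; split; [case=> [<-|[]]; split => //; [left|right] | tauto].
exists r; first by apply/in_app_iff; right.
by move=> x; rewrite rP; split; [tauto | case=> [[<-|]]].
Qed.

(** All sublists keep the order of [s], so in the absence of repetitions the members alone fix the
    list. This makes the set Gamma of an edge sentence unique as a list. *)
Lemma sublists_inj (T : Type) (s r q : seq T) :
  NoDup s -> In r (sublists s) -> In q (sublists s) ->
  (forall x, In x r <-> In x q) -> r = q.
Proof.
elim: s r q => [|y s IH] r q /=; first by move=> _ [<-|//] [<-|//].
case/NoDup_cons_iff=> nys uniq_s.
have ny p : In p (sublists s) -> ~ In y p by move=> ps yp; apply: nys; apply: In_sublists ps yp.
case/in_app_iff=> [/In_map[r' [<- r's]]|rs];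
  case/in_app_iff=> [/In_map[q' [<- q's]]|qs] eq_rq.
- congr cons; apply: IH => // x; have := eq_rq x.
  have [<-|neq] := classic (y = x); last by move=> /=; tauto.
  (* At the head [y] itself both memberships fail, since [y] does not occur in [s]. *)
  by have := ny _ r's; have := ny _ q's; tauto.
- by case: (ny _ qs); apply/eq_rq; left.
- by case: (ny _ rs); apply/eq_rq; left.
- exact: IH.
Qed.

Lemma NoDup_sublists (T : Type) (s : seq T) : NoDup s -> NoDup (sublists s).
Proof.
elim: s => [|x s IH] /=; first by move=> _; apply: NoDup_cons => //; apply: NoDup_nil.
case/NoDup_cons_iff=> nxs uniq_s; apply: NoDup_app; last first.
- by move=> r /In_map[q [<- _]] xqs; apply: nxs; apply: In_sublists xqs _; left.
- exact: IH.
- by apply: NoDup_map_inj; [move=> ? ? [] | apply: IH].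
Qed.

Lemma In_choices_cons (T : Type) (s : seq T) ss r :
  In r (choices (s :: ss)) <->
  exists x q, [/\ r = x :: q, In x s & In q (choices ss)].
Proof.
rewrite /=; elim: s => [|x s IH] /=; first by split=> // -[? [? []]].
split.
  case/in_app_iff=> [/In_map[q [<- qs]]|/IH[y [q [-> ys qs]]]].
    by exists x, q; split=> //; left.
  by exists y, q; split=> //; right.
case=> y [q [def_r [eq_xy|ys] qs]]; apply/in_app_iff.
  by left; apply/In_map; exists q; rewrite eq_xy.
by right; apply/IH; exists y, q.
Qed.

Lemma NoDup_choices (T : Type) (ss : seq (seq T)) :
  every (@NoDup T) ss -> NoDup (choices ss).
Proof.
elim: ss => [_|s ss IH [uniq_s /IH uniq_ss]].
  by apply: NoDup_cons => //; apply: NoDup_nil.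
elim: s uniq_s => [_|x s IHs]; first exact: NoDup_nil.
case/NoDup_cons_iff=> nxs /IHs uniq_c.
apply: NoDup_app => //; first by apply: NoDup_map_inj => // ? ? [].
move=> r /In_map[q [<- _]] /In_choices_cons[y [q' [[eq_xy _] ys _]]].
by apply: nxs; rewrite eq_xy.
Qed.

(** Subtrees occur inside a list of dependent pairs, and conjuncts inside a list; this principle and
    the next supply induction hypotheses for them, at varying signatures. *)
Definition tree_nested_ind (P : forall S, tree S -> Prop)
    (H : forall S (es : seq {l : label S & tree (target l)}),
      every (fun e => P _ (projT2 e)) es -> P S (Node es)) :
    forall S t, P S t :=
  fix tree_rec S (t : tree S) : P S t :=
    let: Node es := t in
    H S es ((fix every_rec es : every (fun e => P _ (projT2 e)) es :=
      if es is e :: es' then conj (tree_rec _ (projT2 e)) (every_rec es')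
      else I) es).

Definition sen_nested_ind (P : forall S, sen S -> Prop)
    (HPrp : forall S p, P S (Prp p)) (HNom : forall S k, P S (Nom k))
    (HAnd : forall S Phi, every (P S) Phi -> P S (And Phi))
    (HNot : forall S phi, P S phi -> P S (Not phi))
    (HDia : forall S a phi, P S phi -> P S (Dia a phi))
    (HAt : forall S k phi, P S phi -> P S (At k phi))
    (HStore : forall S phi, P (ext S) phi -> P S (Store phi))
    (HEx : forall S phi, P (ext S) phi -> P S (Ex phi)) :
    forall S phi, P S phi :=
  fix sen_rec S (phi : sen S) : P S phi :=
    match phi with
    | Prp p => HPrp S p
    | Nom k => HNom S k
    | And Phi => HAnd S Phi ((fix every_rec Phi : every (P S) Phi :=
        if Phi is psi :: Phi' then conj (sen_rec S psi) (every_rec Phi')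
        else I) Phi)
    | Not psi => HNot S psi (sen_rec S psi)
    | Dia a psi => HDia S a psi (sen_rec S psi)
    | At k psi => HAt S k psi (sen_rec S psi)
    | Store psi => HStore S psi (sen_rec (ext S) psi)
    | Ex psi => HEx S psi (sen_rec (ext S) psi)
    end.

(** * Satisfaction of the derived connectives *)

Lemma sat_Or S (Phi : seq (sen S)) (M : model S) (w : M) :
  sat (Or Phi) w <-> exists2 phi, In phi Phi & sat phi w.
Proof.
split=> [nPhi|[phi Phi_phi sat_phi] /everyP nPhi].
  apply: NNPP => none; apply: nPhi; apply/everyP=> _ /In_map[phi [<- Phi_phi]].
  by move=> sat_phi; apply: none; exists phi.
by apply: (nPhi (Not phi)) => //; apply/In_map; exists phi.
Qed.

Lemma sat_And_map S T (f : T -> sen S) s (M : model S) (w : M) :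
  sat (And [seq f x | x <- s]) w <-> forall x, In x s -> sat (f x) w.
Proof.
split=> [/everyP sat_s x xs|sat_s].
  by apply: sat_s; apply/In_map; exists x.
by apply/everyP=> _ /In_map[x [<- /sat_s]].
Qed.

Lemma sat_And2 S (phi psi : sen S) (M : model S) (w : M) :
  sat (And [:: phi; psi]) w <-> sat phi w /\ sat psi w.
Proof. by split=> [[? []]|[]]. Qed.

Lemma sat_Box S a (phi : sen S) (M : model S) (w : M) :
  sat (Box a phi) w <-> forall w1, actI a w w1 -> sat phi w1.
Proof.
split=> [nbox w1 ww1|box [w1 /box sat_phi []] //].
by apply: NNPP => nsat; apply: nbox; exists w1.
Qed.

Lemma sat_All S (phi : sen (ext S)) (M : model S) (w : M) :
  sat (All phi) w <-> forall u : M, sat phi (M := expand u) w.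
Proof.
split=> [nall u|all [u []]]; last exact: all.
by apply: NNPP => nsat; apply: nall; exists u.
Qed.

(** * Partitions of the pointed models by sentences *)

Definition share S (Theta : seq (sen S)) (M N : model S) (w : M) (v : N) :=
  exists phi, In phi Theta /\ (sat phi w /\ sat phi v).

Definition exclusive S (Theta : seq (sen S)) :=
  forall (M : model S) (w : M) phi psi, In phi Theta -> In psi Theta ->
  sat phi w -> sat psi w -> phi = psi.

(** Covering is phrased as [share] on the diagonal, so that the lemmas characterizing [share] for
    edges and conjunctions also prove covering. *)
Record partition S (Theta : seq (sen S)) : Prop := Partition {
  part_uniq : NoDup Theta;
  part_excl : exclusive Theta;
  part_cover : forall (M : model S) (w : M), share Theta w w
}.

(** Exclusivity at [w] identifies the shared sentence with [phi]. *)
Lemma share_sat S (Theta : seq (sen S)) phi (M N : model S) (w : M) (v : N) :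
  exclusive Theta -> share Theta w v -> In phi Theta -> sat phi w -> sat phi v.
Proof.
by move=> excl [psi [Tpsi [wpsi vpsi]]] Tphi wphi; rewrite (excl _ w phi psi).
Qed.

Lemma share_sym S (Theta : seq (sen S)) (M N : model S) (w : M) (v : N) :
  share Theta w v -> share Theta v w.
Proof. by case=> phi [Tphi [? ?]]; exists phi. Qed.

Lemma share_map S U (f : sen U -> sen S) Theta (M N : model S) (w : M) (v : N) :
  share [seq f gamma | gamma <- Theta] w v <->
  exists gamma, In gamma Theta /\ (sat (f gamma) w /\ sat (f gamma) v).
Proof.
split=> [[_ [/In_map[gamma [<- Tg]] ?]]|[gamma [Tg ?]]]; first by exists gamma.
by exists (f gamma); split=> //; apply/In_map; exists gamma.
Qed.

(** * Single rounds of the game *)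

Lemma round_mono S (l : label S) (V W : forall M N : model (target l), M -> N -> Prop)
    (M N : model S) (w : M) (v : N) :
  (forall M N w v, V M N w v -> W M N w v) ->
  round (l := l) V w v -> round (l := l) W w v.
Proof.
case: l V W => [a|k|||] V W VW /=; try exact: VW.
- case=> Vw Vv; split=> [w1 /Vw[v1]|v1 /Vv[w1]] ? ?; [exists v1|exists w1]=> //;
    exact: VW.
- case=> Vw Vv; split=> [w1|v1]; [have [v1] := Vw w1|have [w1] := Vv v1] => ?;
    [exists v1|exists w1]; exact: VW.
Qed.

(** Eloise copies each move of Abelard. *)
Lemma round_refl S (l : label S) (W : forall M N : model (target l), M -> N -> Prop)
    (M : model S) (w : M) :
  (forall M w, W M M w w) -> round (l := l) W w w.
Proof.
case: l W => [a|k|||] W Wrefl /=; try exact: Wrefl.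
- by split=> w1 ?; exists w1.
- by split=> w1; exists w1.
Qed.

(** * Edge sentences as one round of the game *)

Lemma sat_edge_Dia S a (Gamma : seq (sen S)) (M : model S) (w : M) :
  sat (And [:: And [seq Dia a gamma | gamma <- Gamma]; Box a (Or Gamma)]) w <->
  (forall gamma, In gamma Gamma -> exists2 w1, actI a w w1 & sat gamma w1) /\
  (forall w1, actI a w w1 -> exists2 gamma, In gamma Gamma & sat gamma w1).
Proof.
rewrite sat_And2 sat_And_map sat_Box.
split=> [] [some all]; split=> // w1 /all; by move/sat_Or.
Qed.

Lemma sat_edge_Ex S (Gamma : seq (sen (ext S))) (M : model S) (w : M) :
  sat (And [:: And [seq Ex gamma | gamma <- Gamma]; All (Or Gamma)]) w <->
  (forall gamma, In gamma Gamma -> exists u : M, sat gamma (M := expand u) w) /\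
  (forall u : M, exists2 gamma, In gamma Gamma & sat gamma (M := expand u) w).
Proof.
rewrite sat_And2 sat_And_map sat_All.
by split=> [] [some all]; split=> // u; apply/sat_Or.
Qed.

(** Given a common edge sentence, Eloise answers a move by looking up the member of Gamma satisfied
    after it, which the other model realizes as well. Conversely, the members of [Theta] realized by
    the moves from [w] form the Gamma of a common edge sentence. *)
Lemma share_edge S (l : label S) (Theta : seq (sen (target l)))
    (M N : model S) (w : M) (v : N) :
  exclusive Theta ->
  share (edge_sentences Theta) w v <->
  round (l := l) (fun M N => @share _ Theta M N) w v.
Proof.
case: l Theta => [a|k|||] Theta excl; try exact: share_map; last by [].
- split=> /=.
    case=> _ [/In_map[Gamma [<- sG]] [/sat_edge_Dia[sw aw] /sat_edge_Dia[sv av]]].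
    split=> [w1 /aw[g Gg ?]|v1 /av[g Gg ?]].
      by have [v1 ? ?] := sv g Gg; exists v1 => //; exists g; split=> //; apply: In_sublists Gg.
    by have [w1 ? ?] := sw g Gg; exists w1 => //; exists g; split=> //; apply: In_sublists Gg.
  case=> Ww Wv.
  have [Gamma sG GP] := sublists_comprehension
    (fun g => exists2 w1, actI a w w1 & sat g w1) Theta.
  eexists; split; first by apply/In_map; exists Gamma; split.
  split; apply/sat_edge_Dia; split.
  + by move=> g /GP[].
  + move=> w1 ww1; have [v1 _ [g [Tg [? _]]]] := Ww _ ww1.
    by exists g => //; apply/GP; split=> //; exists w1.
  (* Eloise's answer shares some sentence with [w1]; by exclusivity that sentence is [g]. *)
  + move=> g /GP[Tg [w1 ww1 w1g]]; have [v1 vv1 sh] := Ww _ ww1.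
    by exists v1 => //; apply: share_sat sh Tg w1g.
  + move=> v1 vv1; have [w1 ww1 [g [Tg [? ?]]]] := Wv _ vv1.
    by exists g => //; apply/GP; split=> //; exists w1.
- split=> /=.
    case=> _ [/In_map[Gamma [<- sG]] [/sat_edge_Ex[sw aw] /sat_edge_Ex[sv av]]].
    split=> [w1|v1].
      have [g Gg ?] := aw w1; have [v1 ?] := sv g Gg.
      by exists v1, g; split=> //; apply: In_sublists Gg.
    have [g Gg ?] := av v1; have [w1 ?] := sw g Gg.
    by exists w1, g; split=> //; apply: In_sublists Gg.
  case=> Ww Wv.
  have [Gamma sG GP] := sublists_comprehension
    (fun g => exists u : M, sat g (M := expand u) w) Theta.
  eexists; split; first by apply/In_map; exists Gamma; split.
  split; apply/sat_edge_Ex; split.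
  + by move=> g /GP[].
  + move=> w1; have [v1 [g [Tg [? _]]]] := Ww w1.
    by exists g => //; apply/GP; split=> //; exists w1.
  + move=> g /GP[Tg [w1 w1g]]; have [v1 sh] := Ww w1.
    by exists v1; apply: share_sat sh Tg w1g.
  + move=> v1; have [w1 [g [Tg [? ?]]]] := Wv v1.
    by exists g => //; apply/GP; split=> //; exists w1.
Qed.

(** For [LDia] and [LEx], Gamma is forced: each member is realized by a move, and the member of the
    other set true after that move equals it by exclusivity of [Theta]. The remaining labels inherit
    exclusivity at the position moved to. *)
Lemma exclusive_edge S (l : label S) (Theta : seq (sen (target l))) :
  NoDup Theta -> exclusive Theta -> exclusive (edge_sentences Theta).
Proof.
case: l Theta => [a|k|||] Theta uniq excl M w phi psi; last exact: excl.
- move=> /In_map[G [<- sG]] /In_map[H [<- sH]].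
  move=> /sat_edge_Dia[Gs Ga] /sat_edge_Dia[Hs Ha].
  suff -> : G = H by [].
  apply: (sublists_inj uniq) => // g; split=> [Gg|Hg].
    have [w1 ww1 w1g] := Gs g Gg; have [h Hh w1h] := Ha _ ww1.
    by rewrite (excl _ w1 g h) //; [apply: In_sublists Gg|apply: In_sublists Hh].
  have [w1 ww1 w1g] := Hs g Hg; have [h Gh w1h] := Ga _ ww1.
  by rewrite (excl _ w1 g h) //; [apply: In_sublists Hg|apply: In_sublists Gh].
- move=> /In_map[g [<- Tg]] /In_map[h [<- Th]] /= wg wh.
  by rewrite (excl _ _ g h Tg Th wg wh).
- move=> /In_map[g [<- Tg]] /In_map[h [<- Th]] /= wg wh.
  by rewrite (excl _ _ g h Tg Th wg wh).
- move=> /In_map[G [<- sG]] /In_map[H [<- sH]].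
  move=> /sat_edge_Ex[Gs Ga] /sat_edge_Ex[Hs Ha].
  suff -> : G = H by [].
  apply: (sublists_inj uniq) => // g; split=> [Gg|Hg].
    have [u ug] := Gs g Gg; have [h Hh uh] := Ha u.
    by rewrite (excl _ _ g h _ _ ug uh) //; [apply: In_sublists Gg|apply: In_sublists Hh].
  have [u ug] := Hs g Hg; have [h Gh uh] := Ga u.
  by rewrite (excl _ _ g h _ _ ug uh) //; [apply: In_sublists Hg|apply: In_sublists Gh].
Qed.

Lemma NoDup_edge S (l : label S) (Theta : seq (sen (target l))) :
  NoDup Theta -> NoDup (edge_sentences Theta).
Proof.
case: l Theta => [a|k|||] Theta uniq //=; apply: NoDup_map_inj => //;
  try exact: NoDup_sublists; try by move=> ? ? [].
(* The first conjunct, a list of diamonds here and of existentials below, already determines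
   Gamma. *)
- by move=> G H [eqGH _]; elim: G H eqGH => [|g G IH] [|h H] //= [-> /IH->].
- by move=> G H [eqGH _]; elim: G H eqGH => [|g G IH] [|h H] //= [-> /IH->].
Qed.

Lemma partition_edge S (l : label S) (Theta : seq (sen (target l))) :
  partition Theta -> partition (edge_sentences Theta).
Proof.
case=> uniq excl cover; split; [exact: NoDup_edge | exact: exclusive_edge |].
by move=> M w; apply/share_edge => //; apply: round_refl.
Qed.

(** * Conjunctions of choices and basic types *)

Lemma share_choices S (ss : seq (seq (sen S))) (M N : model S) (w : M) (v : N) :
  share [seq And Phi | Phi <- choices ss] w v <->
  every (fun Theta => share Theta w v) ss.
Proof.
elim: ss => [|s ss IH]; first by split=> // _; exists (And [::]); split=> //; left.
split.
  case=> _ [/In_map[_ [<- /In_choices_cons[x [q [-> xs qss]]]]]].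
  case=> [[wx wq] [vx vq]]; split; first by exists x.
  by apply/IH; exists (And q); split=> //; apply/In_map; exists q.
case=> [[x [xs [wx vx]]] /IH[_ [/In_map[q [<- qss]] [wq vq]]]].
exists (And (x :: q)); split=> //; apply/In_map; exists (x :: q); split=> //.
by apply/In_choices_cons; exists x, q.
Qed.

Lemma exclusive_choices S (ss : seq (seq (sen S))) :
  every (@exclusive S) ss -> exclusive [seq And Phi | Phi <- choices ss].
Proof.
move=> excl M w _ _ /In_map[Phi [<- sPhi]] /In_map[Psi [<- sPsi]] wPhi wPsi.
congr And; elim: ss excl Phi Psi sPhi sPsi wPhi wPsi => [_|s ss IH [excl_s excl]] Phi Psi.
  by case=> // <- [].
case/In_choices_cons=> [x [q [-> xs qss]]] /In_choices_cons[y [r [-> ys rss]]].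
move=> [wx wq] [wy wr]; congr cons; first exact: excl_s wx wy.
exact: IH.
Qed.

Lemma partition_choices S (ss : seq (seq (sen S))) :
  every (@partition S) ss -> partition [seq And Phi | Phi <- choices ss].
Proof.
move=> /everyP part; split.
- apply: NoDup_map_inj; first by move=> ? ? [].
  by apply: NoDup_choices; apply/everyP=> s /part[].
- by apply: exclusive_choices; apply/everyP=> s /part[].
- by move=> M w; apply/share_choices/everyP=> s /part[].
Qed.

Lemma partition_basic_types S : partition (basic_types S).
Proof.
apply: partition_choices; apply/everyP=> _ /In_map[rho [<- rhoS]]; split.
- apply: NoDup_cons; last by apply: NoDup_cons => //; apply: NoDup_nil.
  (* A basic sentence is a nominal or a propositional symbol, hence not its own negation. *)
  case=> // eq_rho.
  by move: rhoS => /in_app_iff[]/In_map[k [def_rho _]]; rewrite -def_rho in eq_rho.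
- by move=> M w phi psi [<-|[<-|//]] [<-|[<-|//]].
- move=> M w; have [wrho|nwrho] := classic (sat rho w).
    by exists rho; split=> //; left.
  by exists (Not rho); split=> //; right; left.
Qed.

Lemma share_basic_types S (M N : model S) (w : M) (v : N) :
  share (basic_types S) w v <-> game_property w v.
Proof.
split=> [/share_choices/everyP sh rho rhoS|gp].
  have /sh : In [:: rho; Not rho] [seq [:: r; Not r] | r <- basic S].
    by apply/In_map; exists rho.
  by case=> _ [[<-|[<-|//]] []].
apply/share_choices/everyP=> _ /In_map[rho [<- /gp wv]].
have [wrho|nwrho] := classic (sat rho w).
  by exists rho; split; [left | rewrite -wv].
by exists (Not rho); split; [right; left | rewrite /= -wv].
Qed.

(** * Game sentences and winning strategies *)

Lemma partition_game_sentences c S (t : tree S) : partition (game_sentences c t).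
Proof.
elim/tree_nested_ind: S / t => S [|e es] IH; first exact: partition_basic_types.
have part : every (@partition S)
    [seq edge_sentences (game_sentences c (projT2 e)) | e <- e :: es].
  move/everyP: IH => IH; apply/everyP=> _ /In_map[e' [<- /IH]].
  exact: partition_edge.
case: c part {IH} => part; apply: partition_choices => //.
by split=> //; apply: partition_basic_types.
Qed.

Lemma share_edges c S (es : seq {l : label S & tree (target l)})
    (M N : model S) (w : M) (v : N) :
  every (fun Theta => share Theta w v)
    [seq edge_sentences (game_sentences c (projT2 e)) | e <- es] <->
  every (fun e => round (l := projT1 e)
    (fun M N => @share _ (game_sentences c (projT2 e)) M N) w v) es.
Proof.
have shE (e : {l : label S & tree (target l)}) :=
  share_edge w v (part_excl (partition_game_sentences c (projT2 e))).
split=> /everyP sh; apply/everyP.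
  by move=> e ees; apply/shE/sh/In_map; exists e.
by move=> _ /In_map[e [<- /sh /shE]].
Qed.

(** Basic types enter the conjunction at a node exactly when it is a leaf or [c] is [WithRoot]; the
    premise of the first conjunct records this, so both conventions are treated at once. *)
Lemma share_Node c S (es : seq {l : label S & tree (target l)}) (M N : model S)
    (w : M) (v : N) :
  share (game_sentences c (Node es)) w v <->
  (es = [::] \/ c = WithRoot -> game_property w v) /\
  every (fun e => round (l := projT1 e)
    (fun M N => @share _ (game_sentences c (projT2 e)) M N) w v) es.
Proof.
case: es => [|e es]; first by rewrite share_basic_types /=; tauto.
rewrite -share_edges; case: c; rewrite share_choices.
  by split=> [|[]//]; split=> // -[].
by rewrite -share_basic_types; split=> -[gp sh]; split=> //; apply: gp; right.
Qed.

Lemma eloise_wins_share c S (t : tree S) (M N : model S) (w : M) (v : N) :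
  eloise_wins t w v -> share (game_sentences c t) w v.
Proof.
elim/tree_nested_ind: S / t M N w v => S es /everyP IH M N w v [gp /everyP win].
apply/share_Node; split=> //; apply/everyP=> e ees.
by apply: round_mono (win e ees) => *; apply: IH.
Qed.

(** Under [WithRoot] a shared sentence yields the game property at inner nodes too, which
    [EdgesOnly] does not guarantee. *)
Lemma share_eloise_wins S (t : tree S) (M N : model S) (w : M) (v : N) :
  share (game_sentences WithRoot t) w v -> eloise_wins t w v.
Proof.
elim/tree_nested_ind: S / t M N w v => S es /everyP IH M N w v.
case/share_Node=> gp /everyP sh; split; first by apply: gp; right.
by apply/everyP=> e ees; apply: round_mono (sh e ees) => *; apply: IH.
Qed.

(** * Complete trees *)

Definition labels (L : fragment) S (A : seq (action (modalities S))) : seq (label S) :=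
  List.filter (@label_in L S)
    (nodup (fun l l' => excluded_middle_informative (l = l'))
      ([:: LStore; LEx; LIdle] ++ [seq LAt k | k <- enum (nominals S)] ++
       [seq LDia a | a <- A])).

(* The identity, S and ext S having the same modalities. *)
Definition target_actions S (l : label S) :
    seq (action (modalities S)) -> seq (action (modalities (target l))) :=
  match l with LStore | LEx => id | _ => id end.

Fixpoint complete_tree L n S (A : seq (action (modalities S))) : tree S :=
  if n is n'.+1 then
    Node [seq existT (fun l => tree (target l)) l
                (complete_tree L n' (target_actions l A)) | l <- labels L A]
  else Node [::].

(** [labels] discards repetitions, deciding equality classically, so distinct edges carry distinct
    labels even if [A] has repeated entries. *)
Lemma complete_tree_gameboard L n S (A : seq (action (modalities S))) :
  gameboard L (complete_tree L n A).
Proof.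
elim: n S A => [|n IH] S A /=; first by split=> //; apply: NoDup_nil.
split; last by apply/everyP=> _ /In_map[l [<- /filter_In[]]]; split=> /=.
rewrite -map_comp map_id; exact/NoDup_filter/NoDup_nodup.
Qed.

Lemma In_labels L S (A : seq (action (modalities S))) l :
  label_in L l -> (if l is LDia a then In a A else True) -> In l (labels L A).
Proof.
move=> lL lA; apply/filter_In; split=> //; apply/nodup_In.
case: l lA {lL} => [a aA|k _|_|_|_].
- by do 3 (apply: or_intror); apply/in_app_iff; right; apply/In_map; exists a.
- do 3 (apply: or_intror); apply/in_app_iff; left; apply/In_map.
  by exists k; split=> //; apply: In_enum.
- by left.
- by right; left.
- by right; right; left.
Qed.

Lemma share_complete_tree c L n S (A : seq (action (modalities S))) l
    (M N : model S) (w : M) (v : N) :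
  label_in L l -> (if l is LDia a then In a A else True) ->
  share (game_sentences c (complete_tree L n.+1 A)) w v ->
  round (l := l) (fun M N =>
    @share _ (game_sentences c (complete_tree L n (target_actions l A))) M N) w v.
Proof.
move=> lL lA /share_Node[_ /everyP/(_ (existT _ l _))]; apply.
by apply/In_map; exists l; split=> //; apply: In_labels.
Qed.

(** Following idle edges leads to a leaf with the position unchanged, and at a leaf the game
    sentences are the basic types. Hence this holds for [EdgesOnly] as well. *)
Lemma share_complete_tree_basic c L n S (A : seq (action (modalities S)))
    (M N : model S) (w : M) (v : N) :
  share (game_sentences c (complete_tree L n A)) w v -> game_property w v.
Proof.
elim: n => [|n IH]; first by move/share_basic_types.
by move/(@share_complete_tree c L n S A LIdle M N w v isT I)/IH.
Qed.

(** * Sentences as unions of classes of game sentences *)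

Definition decides c S (t : tree S) (phi : sen S) :=
  forall (M N : model S) (w : M) (v : N),
  share (game_sentences c t) w v -> (sat phi w <-> sat phi v).

Lemma decidesW c S (t : tree S) phi :
  (forall (M N : model S) (w : M) (v : N),
    share (game_sentences c t) w v -> sat phi w -> sat phi v) ->
  decides c t phi.
Proof. by move=> imp M N w v sh; split; apply: imp => //; apply: share_sym. Qed.

(** [A0] collects the actions of [phi], and [n0] bounds the nesting of its modal operators, binders
    and quantifiers. Quantifying over all larger [A] and [n] lets one tree serve all members of a
    conjunction. *)
Lemma complete_trees_decide c L S (phi : sen S) : sen_in L phi ->
  exists (A0 : seq (action (modalities S))) n0, forall A n,
  incl A0 A -> n0 <= n -> decides c (complete_tree L n A) phi.
Proof.
elim/sen_nested_ind: S / phi => S.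
- move=> p _; exists [::], 0 => A n _ _ M N w v /share_complete_tree_basic; apply.
  by apply/in_app_iff; right; apply/In_map; exists p; split=> //; apply: In_enum.
- move=> k _; exists [::], 0 => A n _ _ M N w v /share_complete_tree_basic; apply.
  by apply/in_app_iff; left; apply/In_map; exists k; split=> //; apply: In_enum.
- elim=> [|phi Phi IHPhi] /=; first by exists [::], 0.
  move=> [IHphi /IHPhi{}IHPhi] /andP[/IHphi[A0 [n0 dec0]] /IHPhi[A1 [n1 dec1]]].
  exists (A0 ++ A1), (maxn n0 n1) => A n sA; rewrite geq_max => /andP[le0 le1].
  have /dec0/(_ le0) {}dec0 : incl A0 A by move=> a ?; apply/sA/in_app_iff; left.
  have /dec1/(_ le1) {}dec1 : incl A1 A by move=> a ?; apply/sA/in_app_iff; right.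
  move=> M N w v sh; have := dec0 _ _ _ _ sh; have := dec1 _ _ _ _ sh.
  by move=> /=; tauto.
- move=> phi IH /IH[A0 [n0 dec]]; exists A0, n0 => A n sA le_n M N w v sh /=.
  by rewrite (dec A n sA le_n _ _ _ _ sh).
- move=> a phi IH /and3P[hasD aL /IH[A0 [n0 dec]]].
  (* The extra level is spent on the edge labelled [a], which [a] being in the list makes available.
     By symmetry of [share], it is enough to let Abelard move in [M]. *)
  exists (a :: A0), n0.+1 => A [//|n] sA le_n; apply: decidesW => M N w v.
  move/(@share_complete_tree c L n S A (LDia a)).
  case; rewrite /= ?hasD //; first by apply: sA; left.
  move=> Ww _ [w1 /Ww[v1 vv1 sh] w1phi]; exists v1 => //.
  by apply/(dec A n _ _ _ _ _ _ sh) => // b ?; apply: sA; right.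
- move=> k phi IH /andP[hasA /IH[A0 [n0 dec]]].
  exists A0, n0.+1 => A [//|n] sA le_n M N w v.
  by move/(@share_complete_tree c L n S A (LAt k) M N w v hasA I)/(dec A n sA le_n).
- move=> phi IH /andP[hasS /IH[A0 [n0 dec]]].
  exists A0, n0.+1 => A [//|n] sA le_n M N w v.
  by move/(@share_complete_tree c L n S A LStore M N w v hasS I)/(dec A n sA le_n).
- move=> phi IH /andP[hasE /IH[A0 [n0 dec]]].
  (* As for [Dia]: Abelard names the witness in [M] and Eloise's reply is the witness in [N]. *)
  exists A0, n0.+1 => A [//|n] sA le_n; apply: decidesW => M N w v.
  move/(@share_complete_tree c L n S A LEx M N w v hasE I) => -[Ww _] [u uphi].
  by have [u' sh] := Ww u; exists u'; apply/(dec A n sA le_n _ _ _ _ sh).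
Qed.

(** [Psi] consists of the game sentences compatible with [phi], that is, true together with it at
    some pointed model. As [phi] is decided, one such model suffices for the game sentence to imply
    [phi]; covering gives the other implication. *)
Lemma decided_Or c S (t : tree S) phi : decides c t phi ->
  exists Psi, incl Psi (game_sentences c t) /\
  forall (M : model S) (w : M), sat phi w <-> sat (Or Psi) w.
Proof.
move=> dec; have [Psi sPsi PsiP] := sublists_comprehension
  (fun psi => exists (M : model S) (w : M), sat phi w /\ sat psi w)
  (game_sentences c t).
exists Psi; split=> [psi /PsiP[] //|M w]; rewrite sat_Or; split=> [wphi|].
  have [psi [Tpsi [wpsi _]]] := part_cover (partition_game_sentences c t) w.
  by exists psi => //; apply/PsiP; split=> //; exists M, w.
case=> psi /PsiP[Tpsi [N [v [vphi vpsi]]]] wpsi.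
by apply/(dec N M v w) => //; exists psi.
Qed.

Theorem mainTheorem1 (L : fragment) (Delta : signature) (c : conjuncts) :
  (* (1) *)
  (forall (M : model Delta) (w : M) (tr : tree Delta), gameboard L tr ->
     exists! phi : sen Delta, In phi (game_sentences c tr) /\ sat phi w)
  /\
  (* (2) *)
  (forall (M N : model Delta) (w : M) (v : N) (tr : tree Delta),
     gameboard L tr ->
     (eloise_wins tr w v ->
      exists! phi : sen Delta,
        In phi (game_sentences c tr) /\ (sat phi w /\ sat phi v)) /\
     (c = WithRoot ->
      (exists! phi : sen Delta,
        In phi (game_sentences c tr) /\ (sat phi w /\ sat phi v)) ->
      eloise_wins tr w v))
  /\
  (* (3) *)
  (forall phi : sen Delta, sen_in L phi ->
     exists tr : tree Delta, gameboard L tr /\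
     exists Psi : seq (sen Delta),
       incl Psi (game_sentences c tr) /\
       (forall (M : model Delta) (w : M), sat phi w <-> sat (Or Psi) w)).
Proof.
have part tr := partition_game_sentences (S := Delta) c tr.
split; [|split].
- move=> M w tr _; have [phi [Tphi [wphi _]]] := part_cover (part tr) w.
  exists phi; split=> // psi [Tpsi wpsi].
  exact: part_excl (part tr) _ _ _ _ Tphi Tpsi wphi wpsi.
- move=> M N w v tr _; split.
    case/(eloise_wins_share c)=> phi [Tphi [wphi vphi]].
    exists phi; split=> // psi [Tpsi [wpsi _]].
    exact: part_excl (part tr) _ _ _ _ Tphi Tpsi wphi wpsi.
  (* Existence of a common game sentence suffices here. *)
  by move=> {part} -> [phi [sh _]]; apply: share_eloise_wins; exists phi.
- move=> phi /(complete_trees_decide c)[A [n dec]].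
  exists (complete_tree L n A); split; first exact: complete_tree_gameboard.
  by apply: decided_Or; apply: dec.
Qed.
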